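(* Let $M$ be a closed nil 3-manifold and $\Gamma=\pi_1(M)$. Then there exists a faithful representation $\varphi\colon\Gamma\to\langle\mathfrak N(3,\mathcal O_k),\iota\rangle$ with $k=\mathbb Q(i)$ or $k=\mathbb Q(\zeta_3)$, where $\zeta_3=-\tfrac12+\tfrac{\sqrt{-3}}2$ and $\mathcal O_k$ is the ring of integers of $k$.
   Context: $\mathfrak N_3=\mathbb C\times\mathbb R$ is the 3-dimensional Heisenberg group with product $(\xi_1,t_1)(\xi_2,t_2)=(\xi_1+\xi_2,t_1+t_2+2\operatorname{Im}(\xi_1\bar\xi_2))$. $\mathrm U(1)$ acts by $U(\xi,t)=(U\xi,t)$, $\mathfrak N(3)=\mathfrak N_3\rtimes\mathrm U(1)$, and $\iota$ is the automorphism induced by complex conjugation, $(\xi,t)\mapsto(\bar\xi,-t)$. For a subring $R\subset\mathbb C$, $\mathfrak N_3(R)=\{(\xi,t)\in\mathfrak N_3:\xi\in R,\ t\in\operatorname{Im}R\}$ where $\operatorname{Im}R=\{\operatorname{Im}z:z\in R\}$, $\mathrm U(1;R)=\mathrm U(1)\cap R$, and $\mathfrak N(3,R)=\mathfrak N_3(R)\rtimes\mathrm U(1;R)$. A closed nil 3-manifold is a compact manifold $\mathfrak N_3/\Gamma$ where $\Gamma$ is a discrete subgroup of $\langle\mathfrak N(3),\iota\rangle$ acting freely on $\mathfrak N_3$. *)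

(* Defs.v *)
From HB Require Import structures.
From mathcomp Require Import all_boot all_order all_algebra.
From mathcomp Require Import complex.
From mathcomp Require Import all_classical all_reals topology.
From mathcomp Require Import Rstruct Rstruct_topology.
From Stdlib Require Import Rdefinitions.

Set Implicit Arguments.
Unset Strict Implicit.
Unset Printing Implicit Defensive.

Import Order.TTheory GRing.Theory Num.Theory.
Local Open Scope ring_scope.

Definition RR : rcfType := Rdefinitions.R.
Definition CC := complex RR.

Definition cconj (z : CC) : CC := Complex (complex.Re z) (- complex.Im z).
Definition cIm (z : CC) : RR := complex.Im z.
Definition cRe (z : CC) : RR := complex.Re z.

Definition N3 := (CC * RR)%type.

Definition hmul (x y : N3) : N3 :=
  (x.1 + y.1, x.2 + y.2 + 2 * cIm (x.1 * cconj y.1)).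

Definition iota (x : N3) : N3 := (cconj x.1, - x.2).

Definition urot (u : CC) (x : N3) : N3 := (u * x.1, x.2).

Definition unitC (u : CC) : Prop := u * cconj u = 1.

(* The transformation x |-> (a,s) . U (iota^e x) of N_3.  Every element of
   <N(3), iota> = (N_3 x| U(1)) x| <iota> acts on N_3 in this way. *)
Definition nact (a : CC) (s : RR) (u : CC) (e : bool) (x : N3) : N3 :=
  hmul (a, s) (urot u (if e then iota x else x)).

(* The group <N(3), iota>, realised as a group of transformations of N_3. *)
Definition Nil3Iota (f : N3 -> N3) : Prop :=
  exists a s u e, unitC u /\ f = nact a s u e.

(* For a subring O of C (given as a predicate): the group
   <N(3,O), iota>, with N_3(O) = {(xi,t) : xi in O, t in Im O} and
   U(1;O) = U(1) cap O. *)
Definition ImSet (O : CC -> Prop) (t : RR) : Prop := exists z, O z /\ t = cIm z.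

Definition Nil3IotaOver (O : CC -> Prop) (f : N3 -> N3) : Prop :=
  exists a s u e, O a /\ ImSet O s /\ O u /\ unitC u /\ f = nact a s u e.

(* Coordinates of N_3 = C x R ~ R^3, used for its (Euclidean) topology. *)
Definition coords (x : N3) : (RR * RR) * RR := ((cRe x.1, cIm x.1), x.2).

Definition is_subgroup (G : (N3 -> N3) -> Prop) : Prop :=
  (forall g, G g -> Nil3Iota g) /\
  G id /\
  (forall g h, G g -> G h -> G (g \o h)) /\
  (forall g, G g -> exists h, G h /\ h \o g = id /\ g \o h = id).

(* Gamma is discrete in the Lie group <N(3), iota>: the identity is isolated,
   i.e. some neighbourhood of the identity in the parameters (a, s, u, e)
   meets Gamma only in the identity. *)
Definition is_discrete (G : (N3 -> N3) -> Prop) : Prop :=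
  exists eps : RR, 0 < eps /\
    forall a s u, unitC u -> G (nact a s u false) ->
      `|cRe a| < eps -> `|cIm a| < eps -> `|s| < eps ->
      `|cRe u - 1| < eps -> `|cIm u| < eps ->
      nact a s u false = id.

Definition acts_freely (G : (N3 -> N3) -> Prop) : Prop :=
  forall g x, G g -> g x = x -> g = id.

Definition cocompact (G : (N3 -> N3) -> Prop) : Prop :=
  exists K : set ((RR * RR) * RR), compact K /\
    forall x : N3, exists g y, G g /\ K (coords y) /\ g y = x.

(* Gamma is the fundamental group (deck group) of a closed nil 3-manifold
   N_3 / Gamma. *)
Definition closed_nil3_group (G : (N3 -> N3) -> Prop) : Prop :=
  is_subgroup G /\ is_discrete G /\ acts_freely G /\ cocompact G.

Definition Ci : CC := Complex 0 1.
Definition zeta3 : CC := Complex (- (1 / 2)) (Num.sqrt 3 / 2).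

Definition QQi (z : CC) : Prop := exists p q : rat, z = ratr p + ratr q * Ci.
Definition QQzeta3 (z : CC) : Prop :=
  exists p q : rat, z = ratr p + ratr q * zeta3.

Definition alg_integer (z : CC) : Prop :=
  exists p : {poly int}, p \is monic /\
    root (map_poly (fun n : int => n%:~R : CC) p) z.

Definition ring_of_integers (k : CC -> Prop) (z : CC) : Prop :=
  k z /\ alg_integer z.

Definition faithful_rep (G H : (N3 -> N3) -> Prop)
    (phi : (N3 -> N3) -> (N3 -> N3)) : Prop :=
  (forall g, G g -> H (phi g)) /\
  (forall g h, G g -> G h -> phi (g \o h) = phi g \o phi h) /\
  (forall g h, G g -> G h -> phi g = phi h -> g = h).

(* Main.v *)
Require Import Defs.
From mathcomp Require Import all_boot all_order all_algebra.
From mathcomp Require Import complex.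
From mathcomp Require Import all_classical all_reals topology.
From mathcomp Require Import Rstruct Rstruct_topology.
From mathcomp Require Import normedtype ring lra zify.

(** The rotation parts of the elements (a, s, u, e) of Gamma with e = false
commute, so their commutators are translations.  If the lattice Lambda in C of
horizontal parts of translations of Gamma had real rank less than 2, this would
force the projected action on C to preserve, up to bounded error, a point or a
line, against cocompactness.  Discreteness makes the vertical translations an
infinite cyclic group cZ, and it contains 4 Im (l conj m) for l, m in Lambda.

If some rotation part u is not real, then Im u |l|^2 lies in (c/4)Z for every l
in Lambda, so Lambda has a shortest vector v; since no nonzero x with |x| < 1
satisfies x v in Lambda, Re u is 0 or +-1/2, and by Euclidean division Lambda is
Z[w] v with w = i or w = zeta3.  Dividing by v turns all rotation parts into
elements of Z[w].  Otherwise all rotation parts are +-1, and a real linear change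
of coordinates takes the eigenlines of a reflection, if there is one, to the two
axes; here w = i.

Both changes of coordinates come from automorphisms of the Heisenberg group.
Afterwards a translation normalises two independent elements of Gamma to (1, 0)
and (w, 0).  Conjugating these by an arbitrary element bounds the denominator of
its horizontal part, the twelfth power of an element not involving iota
bounds the denominator of its vertical part, and a vertical translation takes
care of the elements involving iota.  A dilation clears the denominators. *)

Set Implicit Arguments.
Unset Strict Implicit.
Unset Printing Implicit Defensive.
Import Order.TTheory GRing.Theory Num.Theory.
Local Open Scope ring_scope.

(** * Transformations of the Heisenberg group *)

Definition cj (e : bool) (z : CC) : CC := if e then cconj z else z.
Definition sg (e : bool) (t : RR) : RR := if e then - t else t.
Definition nsq (z : CC) : RR := cRe z ^+ 2 + cIm z ^+ 2.

Lemma CC_ext (z w : CC) : cRe z = cRe w -> cIm z = cIm w -> z = w.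
Proof. by case: z w => [a b] [c d] /= -> ->. Qed.

Lemma nactE a s u e x : nact a s u e x =
  (a + u * cj e x.1, s + sg e x.2 + 2 * cIm (a * cconj (u * cj e x.1))).
Proof. by case: e. Qed.

Lemma unitCP u : unitC u <-> nsq u = 1.
Proof.
case: u => a b; rewrite /unitC /nsq /cconj /=; split.
  move=> /(congr1 cRe) /= <-; ring.
by move=> h; apply: CC_ext => /=; rewrite -?h; ring.
Qed.

Lemma nsq1 : nsq 1 = 1. Proof. rewrite /nsq /=; ring. Qed.

Lemma unitC1 : unitC 1. Proof. exact/unitCP/nsq1. Qed.
#[local] Hint Resolve unitC1 : core.

Lemma nsqM z w : nsq (z * w) = nsq z * nsq w.
Proof. case: z w => a b [c d]; rewrite /nsq /=; ring. Qed.

Lemma nsq_cconj z : nsq (cconj z) = nsq z.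
Proof. case: z => a b; rewrite /nsq /=; ring. Qed.

Lemma nsq_cj e z : nsq (cj e z) = nsq z.
Proof. by case: e; rewrite ?nsq_cconj. Qed.

Lemma nsq_ge0 z : 0 <= nsq z.
Proof. by rewrite addr_ge0 ?sqr_ge0. Qed.

Lemma nsq_eq0 z : nsq z = 0 -> z = 0.
Proof.
move/eqP; rewrite /nsq paddr_eq0 ?sqr_ge0 // !sqrf_eq0.
by case/andP=> /eqP h1 /eqP h2; apply: CC_ext.
Qed.

Lemma nsq_gt0 z : z != 0 -> 0 < nsq z.
Proof.
move=> z0; rewrite lt_def nsq_ge0 andbT; apply: contra_neq z0; exact: nsq_eq0.
Qed.

Lemma cconjK : involutive cconj.
Proof. by case=> a b; rewrite /cconj /= opprK. Qed.

Lemma cconjD z w : cconj (z + w) = cconj z + cconj w.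
Proof. by apply: CC_ext; case: z w => a b [c d] /=; ring. Qed.

Lemma cconjM z w : cconj (z * w) = cconj z * cconj w.
Proof. by apply: CC_ext; case: z w => a b [c d] /=; ring. Qed.

Lemma cjK e : involutive (cj e).
Proof. by case: e => // z; rewrite /= cconjK. Qed.

Lemma cjD e z w : cj e (z + w) = cj e z + cj e w.
Proof. by case: e; rewrite //= cconjD. Qed.

Lemma cjM e z w : cj e (z * w) = cj e z * cj e w.
Proof. by case: e; rewrite //= cconjM. Qed.

Lemma cjN e z : cj e (- z) = - cj e z.
Proof. by case: e => //; case: z. Qed.

Lemma cj0 e : cj e 0 = 0.
Proof. by apply: CC_ext; case: e => //=; rewrite oppr0. Qed.

Lemma cj1 e : cj e 1 = 1.
Proof. by apply: CC_ext; case: e => //=; rewrite oppr0. Qed.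

Lemma cconj0 : cconj 0 = 0. Proof. exact: (cj0 true). Qed.

Lemma cconj1 : cconj 1 = 1. Proof. exact: (cj1 true). Qed.

Lemma cconjN z : cconj (- z) = - cconj z. Proof. exact: (cjN true). Qed.

Lemma cIm_cj e z : cIm (cj e z) = sg e (cIm z). Proof. by case: e. Qed.

Lemma cIm_mul2 u z w : unitC u ->
  cIm ((u * z) * cconj (u * w)) = cIm (z * cconj w).
Proof.
move/unitCP=> hu; rewrite -[RHS]mul1r -hu.
case: u {hu} z w => a b [c d] [e f]; rewrite /nsq /=; ring.
Qed.

Lemma cconj_cj e z : cconj (cj e z) = cj e (cconj z).
Proof. by case: e. Qed.

Lemma cIm_cj2 e z w : cIm (cj e z * cconj (cj e w)) = sg e (cIm (z * cconj w)).
Proof. by rewrite cconj_cj -cjM cIm_cj. Qed.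

Lemma unitC_cj e z : unitC z -> unitC (cj e z).
Proof. by move/unitCP=> h; apply/unitCP; rewrite nsq_cj. Qed.

Lemma unitCM z w : unitC z -> unitC w -> unitC (z * w).
Proof. by move=> /unitCP h /unitCP k; apply/unitCP; rewrite nsqM h k mulr1. Qed.

Lemma sgD e s t : sg e (s + t) = sg e s + sg e t.
Proof. by case: e; rewrite //= opprD. Qed.

Lemma sgM e s t : sg e (s * t) = s * sg e t.
Proof. by case: e; rewrite //= mulrN. Qed.

Lemma cImD z w : cIm (z + w) = cIm z + cIm w.
Proof. by case: z w => a b [c d]. Qed.

Lemma cImN z : cIm (- z) = - cIm z.
Proof. by case: z. Qed.

Lemma cImZ (r : RR) z : cIm (r%:C%C * z) = r * cIm z.
Proof. by case: z => a b /=; ring. Qed.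

(** The cocycle of [hmul] is twice the area form [cIm (x * cconj y)], which rotations preserve and
    conjugation negates; so rotations and [iota] act by automorphisms. *)
Lemma nact_comp a s u e b t w f : unitC u ->
  nact a s u e \o nact b t w f =
  nact (a + u * cj e b) (s + sg e t + 2 * cIm (a * cconj (u * cj e b)))
    (u * cj e w) (e (+) f).
Proof.
move=> hu; apply/funext => -[x y] /=; rewrite !nactE /=.
have hcc : cj e (cj f x) = cj (e (+) f) x.
  by case: e; case: f => //=; rewrite cconjK.
congr pair; first by rewrite cjD cjM hcc mulrDr !mulrA addrA.
set p := u * cj e b; set q := u * cj e w * cj (e (+) f) x.
have -> : u * cj e (b + w * cj f x) = p + q by rewrite cjD cjM hcc /p /q; ring.
rewrite !sgD sgM -cIm_cj2 -(cIm_mul2 _ _ hu) cjM hcc -/p mulrA -/q.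
have -> : sg e (sg f y) = sg (e (+) f) y.
  by case: e {hcc p q}; case: f => //=; rewrite opprK.
rewrite !cconjD !mulrDr !mulrDl !cImD; ring.
Qed.

Lemma nact_id : nact 0 0 1 false = id.
Proof.
by apply/funext => -[x y]; rewrite nactE; congr pair; rewrite /= ?mul0r /=; ring.
Qed.

(** The values at [(0, 0)], [(1, 0)] and [(0, 1)] recover [(a, s)], [u] and [e]. *)
Lemma nact_inj a s u e b t w f : nact a s u e = nact b t w f ->
  [/\ a = b, s = t, u = w & e = f].
Proof.
move=> h; have := congr1 (fun F => F (0, 0)) h; have := congr1 (fun F => F (1, 0)) h.
have := congr1 (fun F => F (0, 1)) h.
rewrite !nactE /= !cj0 !cj1 !mulr0 !addr0.
have hc0 : cconj 0 = 0 by exact: (cj0 true).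
have hs0 g : sg g 0 = 0 by case: g; rewrite /= ?oppr0.
rewrite !hc0 !mulr0 !mulr1 !hs0 !addr0.
case=> <- h1 [h2 _] [h3].
move/addrI: h2 => h2.
split=> //.
by move: h1; rewrite h3 => /addrI; case: e {h}; case: f => //=; lra.
Qed.

Definition trans (G : (N3 -> N3) -> Prop) b t := G (nact b t 1 false).

Section Subgroup.
Variable G : (N3 -> N3) -> Prop.
Hypothesis GG : is_subgroup G.

Lemma subgroupM a s u e b t w f : unitC u -> G (nact a s u e) -> G (nact b t w f) ->
  G (nact (a + u * cj e b) (s + sg e t + 2 * cIm (a * cconj (u * cj e b)))
    (u * cj e w) (e (+) f)).
Proof. by move=> hu h1 h2; rewrite -nact_comp //; apply: GG.2.2.1. Qed.

Lemma subgroupV a s u e : unitC u -> G (nact a s u e) ->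
  G (nact (- cj e (cconj u * a)) (- sg e s) (cj e (cconj u)) e).
Proof.
move=> hu hg; have [h [Gh [hgi ghi]]] := GG.2.2.2 _ hg.
suff <- : h = nact (- cj e (cconj u * a)) (- sg e s) (cj e (cconj u)) e by [].
set k := nact _ _ _ e; suff hk : nact a s u e \o k = id.
  by rewrite -[h]/(h \o id) -hk compA hgi.
rewrite nact_comp // -cconj_cj.
have -> : cj e (- cj e (cconj u * a)) = - (cconj u * a).
  by rewrite cjN cjK.
have -> : a + u * - (cconj u * a) = 0 by rewrite mulrN mulrA hu mul1r subrr.
have -> : cconj (u * - (cconj u * a)) = - cconj a.
  by rewrite mulrN mulrA hu mul1r; apply: CC_ext; case: (a) => c d /=.
have -> : cIm (a * - cconj a) = 0 by case: (a) => c d /=; ring.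
rewrite cconj_cj cjK hu addbb mulr0 addr0 -nact_id; congr nact.
by case: (e) => /=; ring.
Qed.

(* The new translation is g (b, t) g^-1 for g = nact a s u e. *)
Lemma trans_conj a s u e b t : unitC u -> G (nact a s u e) -> trans G b t ->
  trans G (u * cj e b) (sg e t + 4 * cIm (a * cconj (u * cj e b))).
Proof.
move=> hu hg hb; have := subgroupM hu hg hb.
rewrite cj1 mulr1 addbF => /subgroupM -/(_ _ _ _ _ hu (subgroupV hu hg)).
rewrite cjK hu addbb /trans; set c := u * cj e b.
have -> : u * cj e (- cj e (cconj u * a)) = - a.
  have -> : cj e (- cj e (cconj u * a)) = - (cconj u * a).
    by rewrite cjN cjK.
  by rewrite mulrN mulrA hu mul1r.
congr (G (nact _ _ _ _)); first by rewrite addrAC subrr add0r.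
have -> : sg e (- sg e s) = - s by case: (e); rewrite /= ?opprK.
case: a c {hg} => x y [z w] /=; ring.
Qed.

Lemma transM b t c r : trans G b t -> trans G c r ->
  trans G (b + c) (t + r + 2 * cIm (b * cconj c)).
Proof. by move=> h1 h2; have := subgroupM unitC1 h1 h2; rewrite /= !mul1r. Qed.

Lemma transV b t : trans G b t -> trans G (- b) (- t).
Proof.
move=> h; have := subgroupV unitC1 h; rewrite /= /trans.
have -> : cconj 1 = 1 by exact: (cj1 true).
by rewrite mul1r.
Qed.

Lemma trans0 : trans G 0 0.
Proof. by rewrite /trans nact_id; exact: GG.2.1. Qed.

(** The commutator of the two translations. It links horizontal parts to the vertical translations
    of [G]. *)
Lemma trans_comm b t c r : trans G b t -> trans G c r ->
  trans G 0 (4 * cIm (b * cconj c)).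
Proof.
move=> hb hc; have := transM (trans_conj unitC1 hb hc) (transV hc).
rewrite /= mul1r subrr /trans.
by congr (G (nact _ _ _ _)); case: b c {hb hc} => x y [z w] /=; ring.
Qed.

Lemma transMn b t n : trans G b t -> trans G (n%:R%:C%C * b) (n%:R * t).
Proof.
move=> hb; elim: n => [|n IH].
  by rewrite rmorph0 !mul0r; exact: trans0.
have := transM hb IH; rewrite /trans -[n.+1]add1n natrD.
congr (G (nact _ _ _ _)); first by rewrite rmorphD rmorph1 mulrDl mul1r.
by case: (b) => x y /=; ring.
Qed.

Lemma transMz b t (n : int) :
  trans G b t -> trans G (n%:~R%:C%C * b) (n%:~R * t).
Proof.
case: n => n; first exact: transMn.
move/(transMn n.+1)/transV; rewrite NegzE mulrNz rmorphN !mulNr; exact.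
Qed.

End Subgroup.

(** * The lattice of horizontal parts *)

Lemma compact_bound (K : set ((RR * RR) * RR)) : compact K ->
  exists M : RR, forall x, K x -> `|x.1.1| <= M /\ `|x.1.2| <= M.
Proof.
move=> cK.
have aux (f : (RR * RR) * RR -> RR) : continuous f ->
    exists M : RR, forall x, K x -> `|f x| <= M.
  move=> cf.
  have cfK : compact (f @` K)%classic.
    apply: continuous_compact cK; exact: continuous_subspaceT.
  have [M [_ hM]] := @compact_bounded Rdefinitions.R Rdefinitions.R^o _ cfK.
  exists (M + 1) => x Kx; apply: (hM (M + 1)); first by rewrite ltrDl ltr01.
  by exists x.
have [|M1 h1] := aux (fun x => x.1.1).
  by move=> x; apply: (@continuous_comp _ _ _ fst fst); apply: cvg_fst.
have [|M2 h2] := aux (fun x => x.1.2).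
  by move=> x; apply: (@continuous_comp _ _ _ fst snd); [apply: cvg_fst|apply: cvg_snd].
exists (Num.max M1 M2) => x Kx; rewrite !le_max h1 ?h2 ?orbT //.
Qed.

(** Cut the half-line into cells of length [d]: the lowest cell that [f] meets on [P] contains a
    single value. *)
Lemma ex_min_separated (R : archiRealFieldType) (T : Type) (P : T -> Prop)
    (f : T -> R) (d : R) : 0 < d -> (forall x, P x -> 0 <= f x) ->
  (forall x y, P x -> P y -> `|f x - f y| < d -> f x = f y) ->
  (exists x, P x) -> exists2 x, P x & forall y, P y -> f x <= f y.
Proof.
move=> d0 f0 sep [x0 Px0].
pose Q n := `[< exists2 x, P x & Num.truncn (f x / d) = n >].
have exQ : exists n, Q n by exists (Num.truncn (f x0 / d)); apply/asboolP; exists x0.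
case: (ex_minnP exQ) => n /asboolP[x Px hx] minn.
exists x => // y Py; rewrite leNgt; apply/negP => ltyx.
have dv0 z : P z -> 0 <= f z / d by move=> Pz; rewrite divr_ge0 ?f0 ?(ltW d0).
have le_n : (n <= Num.truncn (f y / d))%N by apply: minn; apply/asboolP; exists y.
have /andP[_ h1] := truncn_itv (dv0 _ Px); have /andP[h2 _] := truncn_itv (dv0 _ Py).
have : `|f x - f y| < d.
  rewrite ger0_norm ?subr_ge0 ?(ltW ltyx) //.
  move: h1; rewrite hx ltr_pdivrMr // -natr1 mulrDl mul1r => h1.
  have {}h2 : n%:R * d <= f y.
    by rewrite -ler_pdivlMr //; apply: le_trans h2; rewrite ler_nat.
  lra.
by move/(sep _ _ Px Py) => h; move: ltyx; rewrite h ltxx.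
Qed.

Lemma discrete_subgroup_cyclic (R : archiRealFieldType) (S : R -> Prop) (eps : R) :
  0 < eps -> (forall x y, S x -> S y -> S (x - y)) ->
  (forall x, S x -> `|x| < eps -> x = 0) -> (exists2 x, S x & x != 0) ->
  exists c, [/\ 0 < c, S c & forall x, S x -> exists n : int, x = n%:~R * c].
Proof.
move=> e0 SB sep [x0 Sx0 x00].
have S0 : S 0 by rewrite -(subrr x0); apply: SB.
have SN x : S x -> S (- x) by move=> Sx; rewrite -sub0r; apply: SB.
have SD x y : S x -> S y -> S (x + y).
  by move=> Sx Sy; rewrite -[y]opprK; apply: SB => //; apply: SN.
have Sn x (n : nat) : S x -> S (n%:R * x).
  move=> Sx; elim: n => [|n IH]; first by rewrite mul0r.
  by rewrite -natr1 mulrDl mul1r; apply: SD.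
have Sz x (n : int) : S x -> S (n%:~R * x).
  case: n => n Sx; first exact: Sn.
  by rewrite NegzE mulrNz mulNr; apply/SN/Sn.
have [] := @ex_min_separated R R (fun x => S x /\ 0 < x) id eps e0.
- by move=> x [_ /ltW].
- move=> x y [Sx _] [Sy _] /sep h; apply/eqP; rewrite -subr_eq0; apply/eqP.
  exact/h/SB.
- have [h|h] := leP x0 0; last by exists x0.
  exists (- x0); split; first exact: SN.
  by rewrite oppr_gt0 lt_neqAle x00.
move=> c [Sc c0] minc; exists c; split=> // x Sx; exists (Num.floor (x / c)).
have /andP[h1 h2] := real_floor_itv (num_real (x / c)).
have Sr : S (x - (Num.floor (x / c))%:~R * c) by apply: SB => //; apply: Sz.
move: h1; rewrite ler_pdivlMr // => h1; apply/eqP; rewrite eq_le h1 andbT leNgt.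
apply/negP => h3; have := minc _ (conj Sr _); rewrite subr_gt0 => /(_ h3).
rewrite leNgt; case/negP; rewrite ltrBlDr.
by move: h2; rewrite ltr_pdivrMr // intrD mulrDl mul1r addrC.
Qed.

Definition lattice G b := exists t, trans G b t.

Section Lattice.
Variable G : (N3 -> N3) -> Prop.
Hypothesis GG : is_subgroup G.

Lemma latticeD b c : lattice G b -> lattice G c -> lattice G (b + c).
Proof. by move=> [t h] [s k]; eexists; apply: transM h k. Qed.

Lemma latticeN b : lattice G b -> lattice G (- b).
Proof. by move=> [t h]; eexists; apply: transV h. Qed.

Lemma latticeB b c : lattice G b -> lattice G c -> lattice G (b - c).
Proof. by move=> h k; apply: latticeD => //; apply: latticeN. Qed.

Lemma latticeZ (n : int) b : lattice G b -> lattice G (n%:~R%:C%C * b).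
Proof. by move=> [t h]; eexists; apply: transMz h. Qed.

Lemma lattice_stable a s u e b : unitC u -> G (nact a s u e) -> lattice G b ->
  lattice G (u * cj e b).
Proof. by move=> hu hg [t hb]; eexists; apply: trans_conj hu hg hb. Qed.

Lemma same_linear_part a s b t u e : unitC u ->
  G (nact a s u e) -> G (nact b t u e) -> lattice G (a - b).
Proof.
move=> hu ha hb; have := subgroupM GG hu ha (subgroupV GG hu hb).
rewrite cjK hu addbb cjN cjK mulrN mulrA hu mul1r => h.
by eexists; exact: h.
Qed.

Lemma center_cyclic : is_discrete G -> (exists2 t, trans G 0 t & t != 0) ->
  exists c, [/\ 0 < c, trans G 0 c & forall t, trans G 0 t -> exists n : int, t = n%:~R * c].
Proof.
move=> [eps [e0 disc]].
apply: (@discrete_subgroup_cyclic Rdefinitions.R (trans G 0) eps e0).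
  move=> x y hx hy; have := transM GG hx (transV GG hy).
  by rewrite subrr mul0r /= mulr0 addr0.
move=> x hx xe; have := disc 0 x 1 unitC1 hx.
rewrite /= subrr normr0 => /(_ e0 e0 xe e0 e0).
by rewrite -nact_id => /nact_inj[].
Qed.

Hypothesis GC : cocompact G.

(** Cocompactness seen on C: apply it to [(z, 0)] and forget the heights. *)
Lemma cocompact_orbit : exists M : RR, forall z : CC, exists a s u e w,
  [/\ unitC u, G (nact a s u e), z = a + u * cj e w & `|cRe w| <= M /\ `|cIm w| <= M].
Proof.
have [K [/compact_bound[M hM] hK]] := GC.
exists M => z; have [g [y [hg [Ky]]]] := hK (z, 0).
have [a [s [u [e [hu eg]]]]] := GG.1 _ hg.
rewrite eg nactE => -[hz _]; exists a, s, u, e, y.1; split=> //; first by rewrite -eg.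
exact: hM _ Ky.
Qed.

End Lattice.

Lemma norm_lincomb_le (x y z w M : RR) : `|x| <= M -> `|y| <= M ->
  `|x * z + y * w| <= M * (`|z| + `|w|).
Proof.
move=> hx hy; rewrite mulrDr; apply: le_trans (ler_normD _ _) _.
by rewrite !normrM lerD // ler_wpM2r.
Qed.

(** * The lattice of horizontal parts has real rank two *)

Section Rank.
Variable G : (N3 -> N3) -> Prop.
Hypothesis GG : is_subgroup G.
Hypothesis GC : cocompact G.

Lemma eqnorm_parallel (u l : CC) : nsq u = nsq l -> cIm (u * cconj l) = 0 -> l != 0 ->
  u = l \/ u = - l.
Proof.
move=> hn hi /nsq_gt0 l0; pose r := cRe (u * cconj l) / nsq l.
have hu : u = r%:C%C * l.
  have : (nsq l)%:C%C * u = (cRe (u * cconj l))%:C%C * l.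
    apply: CC_ext; move: hi; case: u l {hn l0 r} => a b [c d]; rewrite /nsq /= => hi.
      rewrite !mul0r !subr0.
      apply/eqP; rewrite -subr_eq0; apply/eqP.
      by transitivity (- d * (a * - d + b * c)); [ring|rewrite hi mulr0].
    rewrite !mul0r !addr0.
    apply/eqP; rewrite -subr_eq0; apply/eqP.
    by transitivity (c * (a * - d + b * c)); [ring|rewrite hi mulr0].
  move=> h; rewrite /r rmorphM /= mulrAC -h mulrAC -rmorphM /= divff ?gt_eqF //.
  by rewrite mul1r.
have : r ^+ 2 = 1.
  have : nsq (r%:C%C * l) = nsq l by rewrite -hu.
  rewrite nsqM {1}/nsq /= expr0n /= addr0 => /(congr1 (fun x => x / nsq l)).
  by rewrite mulfK ?divff ?gt_eqF.
move/eqP; rewrite sqrf_eq1 => /orP[]/eqP hr; [left|right]; rewrite hu hr.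
  by rewrite rmorph1 mul1r.
by rewrite rmorphN1 mulN1r.
Qed.

(** If all lattice vectors were parallel to [l], linear parts would send [l] to [l] or [- l], being
    isometries that preserve the lattice. Orbits of bounded sets would then stay in a strip around
    the line of [l], against cocompactness. *)
Lemma rank_not1 l : lattice G l -> l != 0 ->
  exists2 m, lattice G m & cIm (m * cconj l) != 0.
Proof.
move=> Ll l0; apply: contrapT => /forall2NP H.
have {}H m : lattice G m -> cIm (m * cconj l) = 0.
  by move=> hm; have [//|/negP/negPn/eqP] := H m.
have lin a s u e : unitC u -> G (nact a s u e) -> u * cj e l = l \/ u * cj e l = - l.
  move=> hu hg; apply: eqnorm_parallel => //.
    by rewrite nsqM nsq_cj (unitCP _).1 // mul1r.
  exact/H/(lattice_stable GG hu hg).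
(* Up to a positive factor, the signed distance to the line of [l]. *)
pose f z := cIm (z * cconj l).
(* [e] and the sign of the image of [l] determine [u]. Elements sharing both differ by a translation
   along [l], so [f a] is constant on each of the four classes. *)
have bnd (e b : bool) : exists B : RR, forall a s u, unitC u -> G (nact a s u e) ->
    (u * cj e l == l) = b -> `|f a| <= B.
  have [[a [s [u [hu hg hb]]]]|nex] :=
    pselect (exists a s u, [/\ unitC u, G (nact a s u e) & (u * cj e l == l) = b]).
    exists `|f a| => a' s' u' hu' hg' hb'.
    have uu : u' = u.
      have cl0 : cj e l != 0 by apply: contra_neq l0 => h; rewrite -(cjK e l) h cj0.
      apply: (mulIf cl0); have := lin _ _ _ _ hu hg; have := lin _ _ _ _ hu' hg'.
      move: hb hb'; case: b; first by move=> /eqP -> /eqP ->.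
      by move=> /eqP h1 /eqP h2 [//|->] [//|->].
    have := H _ (same_linear_part GG hu (eq_ind _ (fun v => G (nact a' s' v e)) hg' _ uu) hg).
    by rewrite mulrDl cImD -/(f a') mulNr => /eqP; rewrite /f cImN subr_eq0 => /eqP ->.
  by exists 0 => a s u hu hg hb; case: nex; exists a, s, u.
have [B hB] : exists B, forall a s u e, unitC u -> G (nact a s u e) -> `|f a| <= B.
  have [B1 h1] := bnd true true; have [B2 h2] := bnd true false.
  have [B3 h3] := bnd false true; have [B4 h4] := bnd false false.
  exists (Num.max (Num.max B1 B2) (Num.max B3 B4)) => a s u e hu hg; rewrite !le_max.
  move: hg; case: e => hg.
    case E: (u * cj true l == l); first by rewrite (h1 _ _ _ hu hg E).
    by rewrite (h2 _ _ _ hu hg E) orbT.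
  case E: (u * cj false l == l); first by rewrite (h3 _ _ _ hu hg E) orbT.
  by rewrite (h4 _ _ _ hu hg E) !orbT.
have [M hM] := cocompact_orbit GG GC.
(* One more than the bound for [f] on the orbit; the test point below has [f] equal to [C]. *)
pose C := B + M * (`|- cIm l| + `|cRe l|) + 1.
have [a [s [u [e [w [hu hg hz [hr hi]]]]]]] := hM ((C / nsq l)%:C%C * (Ci * l)).
have fw : `|f (u * cj e w)| = `|f w|.
  have hs : cIm (u * cj e w * cconj (u * cj e l)) = sg e (f w).
    by rewrite cIm_mul2 // cIm_cj2.
  have nsg x : `|sg e x| = `|x| by case: (e); rewrite /= ?normrN.
  have [h|h] := lin _ _ _ _ hu hg; first by rewrite -[RHS]nsg -hs h.
  by rewrite -[RHS]nsg -hs h cconjN mulrN cImN normrN.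
have : `|f ((C / nsq l)%:C%C * (Ci * l))| <= C - 1.
  rewrite hz /f mulrDl cImD; apply: le_trans (ler_normD _ _) _.
  have -> : C - 1 = B + M * (`|- cIm l| + `|cRe l|) by rewrite /C; ring.
  rewrite lerD ?(hB _ _ _ _ hu hg) // [X in X <= _]fw.
  have -> : f w = cRe w * - cIm l + cIm w * cRe l.
    by rewrite /f; case: (w) (l) => x y [z v].
  exact: norm_lincomb_le.
have -> : f ((C / nsq l)%:C%C * (Ci * l)) = C.
  transitivity (C / nsq l * nsq l); last by rewrite divfK // gt_eqF // nsq_gt0.
  by rewrite /f; set x := C / nsq l; case: (l) => p q; rewrite /nsq /=; ring.
have := ler_norm C; lra.
Qed.

(** Commutators of elements without [iota] project to lattice vectors, here 0. So these elements
    commute on C, and all fix the centre [a / (1 - u)] of one nontrivial rotation. *)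
Lemma common_fixpoint : (forall l, lattice G l -> l = 0) ->
  exists p, forall a s u, unitC u -> G (nact a s u false) -> a + u * p = p.
Proof.
move=> H.
have [[a [s [u [hu hg u1]]]]|nex] :=
    pselect (exists a s u, [/\ unitC u, G (nact a s u false) & u != 1]); last first.
  (* All rotation parts are 1, so each [a] is a lattice vector, hence 0; every point is fixed. *)
  exists 0 => a s u hu hg; rewrite mulr0 addr0; apply: H; exists s.
  suff u1 : u = 1 by rewrite /trans -u1.
  by apply/eqP; apply: contrapT => /negP u1; case: nex; exists a, s, u.
have u0 : 1 - u != 0 by rewrite subr_eq0 eq_sym.
exists (a / (1 - u)) => b t w hw hh.
have := subgroupM GG hu hg hh; have := subgroupM GG hw hh hg; rewrite /= (mulrC w u) => h1 h2.
have /eqP := H _ (same_linear_part GG (unitCM hu hw) h2 h1).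
rewrite subr_eq0 => /eqP h.
have -> : b = (1 - w) * a / (1 - u).
  apply: (mulIf u0); rewrite divfK //; apply/eqP; rewrite -subr_eq0; apply/eqP.
  transitivity ((b + w * a) - (a + u * b)); last by rewrite h subrr.
  ring.
by field.
Qed.

(** Otherwise elements without [iota] fix a point [p] and those with [iota] send it to a single
    point [q], so orbits of bounded sets stay near [p] and [q]. *)
Lemma lattice_neq0 : exists2 l, lattice G l & l != 0.
Proof.
apply: contrapT => /forall2NP H.
have {}H l : lattice G l -> l = 0.
  by move=> hl; have [//|/negP/negPn/eqP] := H l.
have [p hp] := common_fixpoint H.
have [q hq] : exists q, forall a s u e, unitC u -> G (nact a s u e) ->
    a + u * cj e p = if e then q else p.
  have [[a [s [u [hu hg]]]]|nex] :=
      pselect (exists a s u, unitC u /\ G (nact a s u true)); last first.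
    exists 0 => a s u [] hu hg; last exact: hp hu hg.
    by case: nex; exists a, s, u.
  exists (a + u * cconj p) => b t w [] hw hh; last exact: hp hw hh.
  (* The quotient of two elements involving [iota] does not involve it, hence fixes [p]; so both
     send [p] to the same point. *)
  have := subgroupM GG (unitC_cj true (unitC_cj true hu)) (subgroupV GG hu hg) hh.
  rewrite /= !cconjK => /(hp _ _ _ (unitCM hu (unitC_cj true hw))).
  rewrite cconjM cconjK => h; apply/eqP; rewrite -subr_eq0; apply/eqP.
  rewrite -[LHS]cconjK -[RHS]cconj0; congr cconj.
  have hu' : u * cconj u = 1 by [].
  rewrite !(cconjD, cconjN, cconjM) !cconjK.
  transitivity (cconj u * (- (u * cconj a) + u * cconj b + u * cconj w * p - p)
      + (1 - u * cconj u) * (cconj b - cconj a + cconj w * p)); last first.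
    by rewrite h subrr hu' subrr mulr0 mul0r addr0.
  by ring.
have [M hM] := cocompact_orbit GG GC.
pose B := (M + `|cRe p|) ^+ 2 + (M + `|cIm p|) ^+ 2.
(* A real point at distance at least [B + 1] from [p] and [q], although its squared distance to one
   of them is at most [B]. *)
pose t := `|cRe p| + `|cRe q| + B + 1.
have [a [s [u [e [w [hu hg hz [hr hi]]]]]]] := hM t%:C%C.
have hn : nsq (t%:C%C - (if e then q else p)) = nsq (w - p).
  rewrite -(hq _ _ _ _ hu hg) hz.
  have -> : a + u * cj e w - (a + u * cj e p) = u * cj e (w - p).
    by rewrite cjD cjN; ring.
  by rewrite nsqM nsq_cj (unitCP _).1 // mul1r.
have sqb (x y : RR) : `|x| <= M -> (x - y) ^+ 2 <= (M + `|y|) ^+ 2.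
  move=> hx; rewrite -[_ ^+ 2]ger0_norm ?sqr_ge0 // normrX.
  rewrite ler_pXn2r ?nnegrE ?addr_ge0 // ?(le_trans _ hx) //.
  by apply: le_trans (ler_normB _ _) _; rewrite lerD2r.
have hB : nsq (w - p) <= B.
  rewrite /nsq /B; move: (sqb _ (cRe p) hr) (sqb _ (cIm p) hi).
  by case: (w) (p) => [x y] [z v] /= h1 h2; rewrite lerD.
have B0 : 0 <= B by apply: le_trans hB; exact: nsq_ge0.
have hx : B + 1 <= `|cRe (t%:C%C - (if e then q else p))|.
  apply: le_trans (ler_norm _).
  have := ler_norm (cRe p); have := ler_norm (cRe q).
  have := normr_ge0 (cRe p); have := normr_ge0 (cRe q).
  rewrite /t; move: {t hn hB B0 hz} B => B.
  by case: (e); case: (p) (q) => [x y] [z v] /=; lra.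
have : (B + 1) ^+ 2 <= B.
  apply: le_trans hB; rewrite -hn /nsq -[X in _ <= X + _]real_normK ?num_real //.
  apply: le_trans (_ : _ <= `|cRe (t%:C%C - (if e then q else p))| ^+ 2) _.
    by rewrite ler_pXn2r ?nnegrE // addr_ge0.
  by rewrite lerDl sqr_ge0.
by move: B0; move: (B) => b; nra.
Qed.

Lemma lattice_rank2 : exists l m, [/\ lattice G l, lattice G m & cIm (m * cconj l) != 0].
Proof.
have [l hl l0] := lattice_neq0; have [m hm hi] := rank_not1 hl l0.
by exists l, m.
Qed.

End Rank.

(** * The rings Z[w] *)

(* w is the root in the upper half plane of X^2 - b X + 1: i if b = 0, zeta3 if b = -1. *)
Definition quad w (b : int) :=
  [/\ b = 0 \/ b = -1, w ^+ 2 = b%:~R%:C%C * w - 1, cconj w = b%:~R%:C%C - w & 0 < cIm w].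

Lemma quad_Ci : quad Ci 0.
Proof.
split; first by left.
- by apply: CC_ext => /=; ring.
- by apply: CC_ext => /=; ring.
- exact: ltr01.
Qed.

Lemma quad_zeta3 : quad zeta3 (-1).
Proof.
have h3 : Num.sqrt (3 : RR) ^+ 2 = 3 by rewrite sqr_sqrtr // ler0n.
split; first by right.
- apply: CC_ext => /=; last by field.
  transitivity ((1 / 2) ^+ 2 - (Num.sqrt (3 : RR)) ^+ 2 / 4); first by field.
  by rewrite h3; field.
- by apply: CC_ext => /=; field.
- by rewrite /= divr_gt0 ?sqrtr_gt0 ?ltr0n.
Qed.

(* Membership in Z[w], and in Im Z[w] = Z Im w. *)
Definition Zw (w z : CC) := exists p q : int, z = p%:~R%:C%C + q%:~R%:C%C * w.
Definition Zi (w : CC) (s : RR) := exists n : int, s = n%:~R * cIm w.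

Section Zw.
Variables (w : CC) (b : int).
Hypothesis hw : quad w b.

Lemma Zwz (n : int) : Zw w n%:~R%:C%C.
Proof. by exists n, 0; ring. Qed.

Lemma Zw1 : Zw w 1.
Proof. by exists 1, 0; ring. Qed.

Lemma Zww : Zw w w.
Proof. by exists 0, 1; ring. Qed.

Lemma ZwD x y : Zw w x -> Zw w y -> Zw w (x + y).
Proof. by move=> [p [q ->]] [r [s ->]]; exists (p + r), (q + s); ring. Qed.

Lemma ZwN x : Zw w x -> Zw w (- x).
Proof. by move=> [p [q ->]]; exists (- p), (- q); ring. Qed.

Lemma ZwM x y : Zw w x -> Zw w y -> Zw w (x * y).
Proof.
have [_ hw2 _ _] := hw.
move=> [p [q ->]] [r [s ->]]; exists (p * r - q * s), (p * s + q * r + q * s * b).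
transitivity (p%:~R%:C%C * r%:~R%:C%C + (p%:~R%:C%C * s%:~R%:C%C + q%:~R%:C%C * r%:~R%:C%C) * w
  + q%:~R%:C%C * s%:~R%:C%C * w ^+ 2); first by ring.
by rewrite hw2; ring.
Qed.

Lemma Zw_cconj x : Zw w x -> Zw w (cconj x).
Proof.
have [_ _ hc _] := hw; move=> [p [q ->]]; rewrite cconjD cconjM hc.
have cr (r : RR) : cconj r%:C%C = r%:C%C by apply: CC_ext => //=; ring.
by rewrite !cr; exists (p + q * b), (- q); ring.
Qed.

Lemma Zw_cj e x : Zw w x -> Zw w (cj e x).
Proof. by case: e => // /Zw_cconj. Qed.

Lemma ZiD s t : Zi w s -> Zi w t -> Zi w (s + t).
Proof. by move=> [p ->] [q ->]; exists (p + q); ring. Qed.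

Lemma ZiN s : Zi w s -> Zi w (- s).
Proof. by move=> [p ->]; exists (- p); ring. Qed.

Lemma ZiZ (n : int) s : Zi w s -> Zi w (n%:~R * s).
Proof. by move=> [p ->]; exists (n * p); ring. Qed.

Lemma Zi_Im x : Zw w x -> Zi w (cIm x).
Proof. by move=> [p [q ->]]; exists q; rewrite cImD cImZ /=; ring. Qed.

Lemma quad_Re : 2 * cRe w = b%:~R.
Proof.
have [_ _ /(congr1 cRe) + _] := hw; case: (w) => x y /= h.
by rewrite -[b%:~R](addrNK x) -h; ring.
Qed.

Lemma nsq_quad : nsq w = 1.
Proof.
have [_ h1 h2 _] := hw; have : w * cconj w = 1.
  by rewrite h2; transitivity (b%:~R%:C%C * w - w ^+ 2); [ring|rewrite h1; ring].
by move/unitCP.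
Qed.

Lemma nsq_Zw (p q : RR) : nsq (p%:C%C + q%:C%C * w) = p ^+ 2 + b%:~R * p * q + q ^+ 2.
Proof.
transitivity (p ^+ 2 + (2 * cRe w) * p * q + q ^+ 2 * nsq w).
  by case: (w) => x y; rewrite /nsq /=; ring.
by rewrite quad_Re nsq_quad mulr1.
Qed.

Lemma quad_exp12 : w ^+ 12 = 1.
Proof.
have [[] hb h _ _] := hw; move: h; rewrite hb => h.
  have -> : w ^+ 12 = (w ^+ 2) ^+ 6 by ring.
  by rewrite h; ring.
have -> : w ^+ 12 = ((w ^+ 2) ^+ 2) ^+ 3 by ring.
have -> : (w ^+ 2) ^+ 2 = w.
  by rewrite {1}h; transitivity (w ^+ 2 + 2%:R * w + 1); [ring|rewrite h; ring].
transitivity (w ^+ 2 * w); [ring|rewrite h].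
by transitivity (- w ^+ 2 - w); [ring|rewrite h; ring].
Qed.

(** 12 is the least common multiple of 4 and 6, the orders of the unit groups of Z[i] and Z[zeta3].
    The norm form bounds [p] and [q], leaving +-1, +-w and, for [b = -1], also +-(1 + w). *)
Lemma Zw_unit12 u : Zw w u -> unitC u -> u ^+ 12 = 1.
Proof.
move=> [p [q ->]] /unitCP; rewrite nsq_Zw => h.
have {}h : p ^+ 2 + b * p * q + q ^+ 2 = 1.
  by apply: (@intr_inj RR); rewrite -[RHS]h; ring.
have [hb hw2 _ _] := hw.
have hq : (q == 0) || (q == 1) || (q == -1) by case: hb h => ->; nia.
have hp : (p == 0) || (p == 1) || (p == -1) by case: hb h => ->; nia.
have w12 := quad_exp12.
have E1 : w ^+ 2 = - (1 + w) -> (1 + w) ^+ 12 = 1.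
  move=> E; have -> : 1 + w = - w ^+ 2 by rewrite E; ring.
  by transitivity ((w ^+ 12) ^+ 2); [ring | rewrite w12; ring].
case/orP: hq => [/orP[]|] /eqP hq; case/orP: hp => [/orP[]|] /eqP hp; subst p q.
all: try by exfalso; case: hb h => ->; lia.
all: try by ring.
all: try by transitivity (w ^+ 12); [ring|].
all: have E : (1 + w) ^+ 12 = 1 by apply: E1; case: hb h hw2 => -> ; [lia|move=> _ ->; ring].
all: try by transitivity ((1 + w) ^+ 12); [ring|].
Qed.

End Zw.

(** * Conjugation into the integral group *)

Definition NilZ w f := exists a s u e,
  [/\ Zw w a, Zi w s, Zw w u, unitC u & f = nact a s u e].

(** [F] is any bijection, since dilations and linear changes of coordinates lie outside [Nil3Iota]
    in general; conjugation by it is still an injective homomorphism. *)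
Definition conj_int w (G : (N3 -> N3) -> Prop) := exists F F' : N3 -> N3,
  [/\ cancel F F', cancel F' F & forall g, G g -> NilZ w (F' \o g \o F)].

Definition conjG (F F' : N3 -> N3) (G : (N3 -> N3) -> Prop) : (N3 -> N3) -> Prop :=
  fun f => G (F \o f \o F').

Lemma conj_cancel (F F' : N3 -> N3) g : cancel F' F -> F \o (F' \o g \o F) \o F' = g.
Proof. by move=> h; apply/funext => x /=; rewrite !h. Qed.

Lemma conj_intJ w F F' G : cancel F F' -> cancel F' F ->
  conj_int w (conjG F F' G) -> conj_int w G.
Proof.
move=> FK F'K [H [H' [HK H'K hH]]]; exists (F \o H), (H' \o F'); split.
- exact: can_comp.
- exact: can_comp.
move=> g Gg; apply: (hH (F' \o g \o F)).
by rewrite /conjG conj_cancel.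
Qed.

Lemma conj_subgroup F F' G : cancel F F' -> cancel F' F -> is_subgroup G ->
  (forall g, G g -> Nil3Iota (F' \o g \o F)) -> is_subgroup (conjG F F' G).
Proof.
move=> FK F'K [_ [G1 [mulG invG]]] hN; split=> [g hg|]; last split; last split.
- by have := hN _ hg; rewrite conj_cancel.
- rewrite /conjG; suff -> : F \o id \o F' = id by [].
  by apply/funext => x /=.
- move=> g h hg hh; have := mulG _ _ hg hh; rewrite /conjG.
  by congr G; apply/funext => x /=; rewrite FK.
- move=> g hg; have [h [Gh [hK Kh]]] := invG _ hg.
  exists (F' \o h \o F); split; first by rewrite /conjG conj_cancel.
  split; apply/funext => x /=.
    by have /= := congr1 (fun f => f (F x)) hK; rewrite FK => ->.
  by have /= := congr1 (fun f => f (F x)) Kh; move=> /(congr1 F'); rewrite !FK.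
Qed.

Lemma nact_translate_conj v r a s u e : unitC u ->
  nact (- v) (- r) 1 false \o nact a s u e \o nact v r 1 false =
  nact (a - v + u * cj e v)
    (s - r + sg e r - 2 * cIm (v * cconj a) + 2 * cIm ((a - v) * cconj (u * cj e v))) u e.
Proof.
move=> hu; rewrite nact_comp // nact_comp /= ?mul1r // cj1 mulr1 addbF.
congr nact; first by ring.
rewrite mulNr cImN [- v + a]addrC; ring.
Qed.

Lemma translate_cancel v r : cancel (nact v r 1 false) (nact (- v) (- r) 1 false).
Proof.
move=> x; have := congr1 (fun f => f x) (nact_comp (- v) (- r) false v r 1 false unitC1).
rewrite /= => ->; rewrite !mul1r !addNr.
have -> : 0 + 2 * cIm (- v * cconj v) = 0 by case: v => p q /=; ring.
by rewrite nact_id.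
Qed.

Lemma translate_cancelV v r : cancel (nact (- v) (- r) 1 false) (nact v r 1 false).
Proof. by have := translate_cancel (- v) (- r); rewrite !opprK. Qed.

(* Every real linear map of C has the form Lin al be, with determinant delta al be;
   hat al be is the induced automorphism of the Heisenberg group. *)
Definition Lin (al be x : CC) := al * x + be * cconj x.
Definition delta al be := nsq al - nsq be.
Definition hat al be (x : N3) : N3 := (Lin al be x.1, delta al be * x.2).
Definition Lin' al be (x : CC) := (delta al be)^-1%:C%C * (cconj al * x - be * cconj x).
Definition hat' al be (x : N3) : N3 := (Lin' al be x.1, (delta al be)^-1 * x.2).

Section Hat.
Variables al be : CC.
Hypothesis d0 : delta al be != 0.

Lemma LinK : cancel (Lin al be) (Lin' al be).
Proof.
move=> x; rewrite /Lin' /Lin.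
have -> : cconj al * (al * x + be * cconj x) - be * cconj (al * x + be * cconj x) =
    (delta al be)%:C%C * x.
  rewrite /delta; apply: CC_ext; case: (al) (be) x => p q [r s] [y z];
    by rewrite /nsq /=; ring.
by rewrite mulrA -rmorphM /= mulVf // mul1r.
Qed.

Lemma LinK' : cancel (Lin' al be) (Lin al be).
Proof.
move=> x; rewrite /Lin' /Lin.
set c := _%:C%C; set y := cconj al * x - be * cconj x.
have -> : cconj (c * y) = c * cconj y by apply: CC_ext; case: (y) => p q; rewrite /c /=; ring.
transitivity (c * (al * y + be * cconj y)); first by ring.
have -> : al * y + be * cconj y = (delta al be)%:C%C * x.
  rewrite /delta /y; apply: CC_ext; case: (al) (be) x {y} => p q [r s] [y z];
    by rewrite /nsq /=; ring.
by rewrite mulrA -rmorphM /= mulVf // mul1r.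
Qed.

Lemma hatK : cancel (hat al be) (hat' al be).
Proof. by case=> x t; rewrite /hat /hat' /= LinK mulrA mulVf // mul1r. Qed.

Lemma hatK' : cancel (hat' al be) (hat al be).
Proof. by case=> x t; rewrite /hat /hat' /= LinK' mulrA mulfV // mul1r. Qed.

(** A real linear map scales area by its determinant; this makes [hat] an automorphism. *)
Lemma cIm_Lin x y : cIm (Lin al be x * cconj (Lin al be y)) = delta al be * cIm (x * cconj y).
Proof.
by rewrite /Lin /delta; case: (al) (be) x y => p q [r s] [x z] [y v]; rewrite /nsq /=; ring.
Qed.

Lemma LinD x y : Lin al be (x + y) = Lin al be x + Lin al be y.
Proof. by rewrite /Lin cconjD; ring. Qed.

(** Since [hat] is an automorphism, only the linear parts need to be intertwined. *)
Lemma hat_conj a s u e u' : (forall x, u * cj e (Lin al be x) = Lin al be (u' * cj e x)) ->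
  hat' al be \o nact a s u e \o hat al be = nact (Lin' al be a) ((delta al be)^-1 * s) u' e.
Proof.
move=> hu; apply/funext => -[x t] /=; apply: (can_inj hatK); rewrite hatK'.
rewrite !nactE /hat /= hu LinD LinK'; congr pair.
by rewrite -{1}(LinK' a) cIm_Lin sgM; field.
Qed.

End Hat.

(** * Bounding denominators in a normalised group *)

Section Integral.
Variables (w : CC) (b : int).
Hypothesis hw : quad w b.
Variables (G : (N3 -> N3) -> Prop) (m : int).
Hypothesis GG : is_subgroup G.
Hypothesis m0 : m != 0.
Hypothesis GU : forall a s u e, unitC u -> G (nact a s u e) -> Zw w u.
Hypothesis G1 : trans G 1 0.
Hypothesis Gw : trans G w 0.
Hypothesis GZ : forall t, trans G 0 t -> Zi w (m%:~R * t / 4).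

Local Notation mr := (m%:~R : RR).

(** A product of powers of [(1, 0)] and [(w, 0)] has the same horizontal part; the quotient by it is
    vertical and [GZ] applies. *)
Lemma trans_vertical z t : Zw w z -> trans G z t -> Zi w (mr * t / 2).
Proof.
move=> [p [q ->]] hz.
have := transM GG (transMz GG p G1) (transMz GG q Gw); rewrite mulr1 !mulr0 !addr0 add0r => h0.
have := transM GG hz (transV GG h0).
rewrite subrr => /GZ [n hn]; exists (2 * n - m * p * q).
move: hn; set A := cIm (_ * cconj (- _)); set B := cIm (_ * cconj (_ * w)).
have -> : B = - (p%:~R * q%:~R * cIm w) by rewrite /B; case: (w) => x y /=; ring.
have -> : A = 0 by rewrite /A; case: (w) => x y /=; ring.
move=> h; transitivity (2 * (n%:~R * cIm w) - mr * p%:~R * q%:~R * cIm w); last by ring.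
by rewrite -h; field.
Qed.

(** The conjugates of [(1, 0)] and [(w, 0)] have horizontal parts in Z[w], so [trans_vertical]
    controls their heights. These are two independent real linear forms in [a], which determine
    it. *)
Lemma horizontal_part a s u e : unitC u -> G (nact a s u e) -> Zw w ((2 * mr)%:C%C * a).
Proof.
move=> hu hg; have Zu := GU hu hg; have [hb _ _ w0] := hw.
have [n1 h1] := trans_vertical (ZwM hw Zu (Zw_cj hw e (Zw1 w))) (trans_conj GG hu hg G1).
have [n2 h2] := trans_vertical (ZwM hw Zu (Zw_cj hw e (Zww w))) (trans_conj GG hu hg Gw).
move: h1 h2; have -> : sg e 0 = 0 by case: (e); rewrite /= ?oppr0.
rewrite cj1 mulr1 !add0r cconjM.
have -> : a * (cconj u * cconj (cj e w)) = (cconj u * a) * cconj (cj e w) by ring.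
rewrite [a * _]mulrC; set a' := cconj u * a => h1 h2.
suff H : Zw w ((2 * mr)%:C%C * a').
  have := ZwM hw Zu H; congr Zw.
  transitivity ((u * cconj u) * ((2 * mr)%:C%C * a)); first by rewrite /a'; ring.
  by rewrite hu mul1r.
have hr := quad_Re hw.
have e1 : 2 * mr * cIm a' = n1%:~R * cIm w by rewrite -h1; field.
have {h1 h2} e2 : 2 * mr * cIm (a' * cconj (cj e w)) = n2%:~R * cIm w by rewrite -h2; field.
have gt0 : cIm w != 0 by rewrite gt_eqF.
(* The imaginary part gives the coefficient [n1] of [w]; the other comes from [n2], corrected when
   [e] is true because [w ^+ 2] has imaginary part [b * cIm w]. *)
exists (if e then n2 - b * n1 else - n2), n1; apply: CC_ext; last first.
  by move: e1; case: (w) (a') => x y [z v] /= e1; rewrite mul0r addr0 e1; ring.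
apply: (mulIf gt0).
have -> : (if e then n2 - b * n1 else - n2)%:~R =
    if e then n2%:~R - b%:~R * n1%:~R else - n2%:~R :> RR by case: (e); ring.
rewrite -hr; move: e1 e2; move: (n1%:~R : RR) (n2%:~R : RR) (2 * mr) => k1 k2 N.
case: (w) (a') => x y [z v] /= e1; have e1x := congr1 (fun t => t * x) e1.
by case: (e) => /= e2; move: e1x e2 => /=; nra.
Qed.

Local Lemma mr0 : mr != 0. Proof. by rewrite intr_eq0. Qed.

Lemma cIm_horizontal x y : Zw w ((2 * mr)%:C%C * x) -> Zw w ((2 * mr)%:C%C * y) ->
  Zi w (4 * mr ^+ 2 * cIm (x * cconj y)).
Proof.
move=> hx hy; have := Zi_Im (ZwM hw hx (Zw_cconj hw hy)); congr Zi.
case: x y {hx hy} => p q [r s] /=; ring.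
Qed.

(** Without [iota], the height of the power is [n * s] plus cocycle terms, which [cIm_horizontal]
    controls. *)
Lemma power_part a s u n : unitC u -> G (nact a s u false) -> exists c t,
  [/\ G (nact c t (u ^+ n) false), Zw w ((2 * mr)%:C%C * c) &
      Zi w (2 * mr ^+ 2 * (t - n%:R * s))].
Proof.
move=> hu hg; have ha := horizontal_part hu hg; have Zu := GU hu hg.
elim: n => [|n [c [t [hc Zc Zt]]]].
  exists 0, 0; split; first by rewrite nact_id; exact: GG.2.1.
    by rewrite mulr0; exact: (Zwz w 0).
  by exists 0; ring.
have Zuc : Zw w ((2 * mr)%:C%C * (u * c)) by rewrite mulrCA; exact: (ZwM hw).
exists (a + u * c), (s + t + 2 * cIm (a * cconj (u * c))); split.
- by have := subgroupM GG hu hg hc; rewrite /= exprS.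
- by rewrite mulrDr; exact: ZwD.
- have := ZiD Zt (cIm_horizontal ha Zuc); congr Zi.
  by rewrite -natr1; ring.
Qed.

(* Since u ^ 12 = 1, the twelfth power of the element is a translation. *)
Lemma vertical_part a s u : unitC u -> G (nact a s u false) -> Zi w (24 * mr ^+ 2 * s).
Proof.
move=> hu hg; have Zu := GU hu hg.
have [c [t [hc Zc Zt]]] := power_part 12 hu hg.
move: hc; rewrite (Zw_unit12 hw Zu hu) => hc.
(* The factor [2 * m] brings the horizontal part into Z[w], as [trans_vertical] requires. *)
have := transMz GG (2 * m) hc.
have -> : (2 * m)%:~R%:C%C = (2 * mr)%:C%C by rewrite intrM.
move=> /(trans_vertical Zc) /(ZiZ 2) /ZiD /(_ (ZiN Zt)); congr Zi.
by rewrite intrM; field.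
Qed.

(** The height [s] cancels in the square of such an element, so only differences are controlled: the
    quotient of two of them is free of [iota]. *)
Lemma vertical_part_iota a s u a0 s0 u0 : unitC u -> unitC u0 ->
  G (nact a s u true) -> G (nact a0 s0 u0 true) -> Zi w (24 * mr ^+ 2 * (s - s0)).
Proof.
move=> hu hu0 hg hg0; have ha := horizontal_part hu hg.
have ha0 := horizontal_part hu0 hg0; have Zu := GU hu hg; have Zu0 := GU hu0 hg0.
have := subgroupM GG hu hg (subgroupV GG hu0 hg0).
rewrite cjN cjK cjK => /(vertical_part (unitCM hu (unitC_cj true hu0))).
have Zuu : Zw w (- (u * cconj u0)) by apply/ZwN/(ZwM hw) => //; exact: (Zw_cconj hw).
have hv : Zw w ((2 * mr)%:C%C * (u * - (cconj u0 * a0))).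
  by have := ZwM hw Zuu ha0; congr Zw; ring.
move=> /ZiD /(_ (ZiN (ZiZ 12 (cIm_horizontal ha hv)))); congr Zi.
by rewrite /=; ring.
Qed.

Lemma conj_int_normalized : conj_int w G.
Proof.
(* A vertical conjugation by [r] keeps heights without [iota] and lowers the others by [2 * r];
   [r = s0 / 2] turns them into differences. *)
have [r hr] : exists r, forall a s u e, unitC u -> G (nact a s u e) ->
    Zi w (24 * mr ^+ 2 * (s - r + sg e r)).
  have [[a0 [s0 [u0 [hu0 hg0]]]]|nex] :=
      pselect (exists a s u, unitC u /\ G (nact a s u true)).
    exists (s0 / 2) => a s u [] hu hg /=.
      by have := vertical_part_iota hu hu0 hg hg0; congr Zi; field.
    by have := vertical_part hu hg; congr Zi; ring.
  exists 0 => a s u [] hu hg /=; first by case: nex; exists a, s, u.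
  by have := vertical_part hu hg; congr Zi; ring.
(* Undoing this dilation multiplies horizontal parts by [24 * m] and heights by its square,
   multiples of the denominators [2 * m] and [24 * m ^+ 2]. *)
pose N : RR := (24 * mr)^-1.
have N0 : N != 0 by rewrite invr_eq0 mulf_neq0 ?mr0 ?pnatr_eq0.
have dN : delta N%:C%C 0 = N ^+ 2 by rewrite /delta /nsq /=; ring.
have d0 : delta N%:C%C 0 != 0 by rewrite dN sqrf_eq0.
apply: (conj_intJ (translate_cancel 0 r) (translate_cancelV 0 r)).
exists (hat N%:C%C 0), (hat' N%:C%C 0); split; [exact: hatK|exact: hatK'|].
move=> g hg; have [a [s [u [e [hu eg]]]]] := GG.1 _ hg.
have hg' : G (nact a s u e) by rewrite -eg.
have -> : g = nact a (s - r + sg e r) u e.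
  rewrite -[g](conj_cancel _ (translate_cancel 0 r)) eg nact_translate_conj //.
  rewrite cj0 mulr0 cconj0 mul0r mulr0 subr0 addr0; congr nact.
  by rewrite mulr0 /= mulr0 subr0 addr0.
rewrite (@hat_conj _ _ d0 _ _ _ _ u); last first.
  move=> x; rewrite /Lin cjD !cjM; have -> : cj e N%:C%C = N%:C%C.
    by case: (e) => //=; apply: CC_ext => /=; ring.
  by rewrite cj0; ring.
have mrN0 := mr0.
eexists _, _, u, e; split; [| |exact: GU hg'|exact: hu|reflexivity].
  have := ZwM hw (Zwz w 12) (horizontal_part hu hg'); congr Zw.
  rewrite /Lin' dN.
  have -> : cconj N%:C%C = N%:C%C by apply: CC_ext => /=; ring.
  rewrite mul0r subr0 mulrA [RHS]mulrA -!rmorphM /=; congr (_%:C%C * _).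
  by rewrite /N; field.
have := ZiZ 24 (hr _ _ _ _ hu hg'); congr Zi.
by rewrite dN /N; field.
Qed.

End Integral.

(** * Reduction to the normalised group *)

Section Reduction.
Variables (w : CC) (b : int).
Hypothesis hw : quad w b.
Variables (G : (N3 -> N3) -> Prop) (c : RR).
Hypothesis GG : is_subgroup G.
Hypothesis Gc : forall t, trans G 0 t -> exists n : int, t = n%:~R * c.

Lemma conj_int_lattice s1 s2 :
  (forall a s u e, unitC u -> G (nact a s u e) -> Zw w u) ->
  trans G 1 s1 -> trans G w s2 -> conj_int w G.
Proof.
move=> GU G1 Gw; have [_ _ _ w0] := hw; have wn0 : cIm w != 0 by rewrite gt_eqF.
(* The commutator of the translations along [w] and 1 gives [4 * cIm w = m * c]. *)
have [m hm] := Gc (trans_comm GG Gw G1); move: hm; rewrite cconj1 mulr1 => hm.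
have m0 : m != 0.
  apply: contra_neq wn0 => m0; move: hm; rewrite m0 mul0r => /eqP.
  by rewrite mulf_eq0 pnatr_eq0 => /eqP.
(* Conjugation by a translation changes heights by a linear form in the horizontal part; as 1 and
   [w] are independent, some [v] kills both heights. *)
have [v [v1 vw]] : exists v, s1 + 4 * cIm (cconj v) = 0 /\ s2 + 4 * cIm (w * cconj v) = 0.
  exists (Complex ((cRe w * (s1 / 4) - s2 / 4) / cIm w) (s1 / 4)).
  by case: (w) wn0 => x y /= wn0; split; field.
pose T := nact v 0 1 false; pose T' := nact (- v) (- 0) 1 false.
have TK : cancel T T' := translate_cancel v 0.
have T'K : cancel T' T := translate_cancelV v 0.
have conjE a s u e : unitC u -> exists a' s', T \o nact a s u e \o T' = nact a' s' u e.
  move=> hu; have := nact_translate_conj (- v) (- 0) a s e hu; rewrite !opprK => h.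
  by eexists _, _; exact: h.
have tr z t : trans G z t -> trans (conjG T T' G) z (t + 4 * cIm (z * cconj v)).
  rewrite /trans /conjG => hz.
  have <- : T' \o nact z t 1 false \o T = nact z (t + 4 * cIm (z * cconj v)) 1 false.
    rewrite nact_translate_conj //=; congr nact; rewrite mul1r; first by rewrite subrK.
    by case: (v) z {hz} => p q [x y] /=; ring.
  by rewrite conj_cancel.
apply: (conj_intJ TK T'K).
apply: (@conj_int_normalized w b hw _ m).
- apply: conj_subgroup => // g /GG.1 [a [s [u [e [hu ->]]]]].
  by eexists _, _, u, e; split=> //; exact: nact_translate_conj.
- exact: m0.
- move=> a s u e hu; rewrite /conjG; have [a' [s' ->]] := conjE a s u e hu.
  exact: GU.
- have := tr _ _ G1; rewrite mul1r; by rewrite v1.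
- have := tr _ _ Gw; by rewrite vw.
move=> t; rewrite /trans /conjG.
have -> : T \o nact 0 t 1 false \o T' = nact 0 t 1 false.
  have := nact_translate_conj (- v) (- 0) 0 t false unitC1; rewrite !opprK /T /T' => ->.
  congr nact; rewrite /= mul1r; first by rewrite add0r addrN.
  by case: (v) => p q /=; ring.
move=> /Gc [n ->]; exists n.
by transitivity (n%:~R * (m%:~R * c) / 4); [ring|rewrite -hm; field].
Qed.

End Reduction.

(** Undoing [hat al be] moves the two lattice vectors to 1 and [w], the position required by
    [conj_int_lattice]. *)
Lemma conj_int_hat w b G c al be : quad w b -> is_subgroup G ->
  (forall t, trans G 0 t -> exists n : int, t = n%:~R * c) ->
  delta al be != 0 -> lattice G (Lin al be 1) -> lattice G (Lin al be w) ->
  (forall a s u e, unitC u -> G (nact a s u e) -> exists u',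
    [/\ Zw w u', unitC u' & forall x, u * cj e (Lin al be x) = Lin al be (u' * cj e x)]) ->
  conj_int w G.
Proof.
move=> hw GG Gc d0 [t1 h1] [t2 h2] GU.
pose F := hat al be; pose F' := hat' al be.
have FK : cancel F F' := hatK d0; have F'K : cancel F' F := hatK' d0.
apply: (conj_intJ FK F'K).
have tr z t : trans G (Lin al be z) t -> trans (conjG F F' G) z ((delta al be)^-1 * t).
  rewrite /trans /conjG => hz.
  have := @hat_conj al be d0 (Lin al be z) t 1 false 1; rewrite LinK // => <-; last first.
    by move=> x; rewrite !mul1r.
  by rewrite conj_cancel.
apply: (@conj_int_lattice w b hw _ (c / delta al be) _ _ _ _ _ (tr _ _ h1) (tr _ _ h2)).
- apply: conj_subgroup => // g Gg; have [a [s [u [e [hu eg]]]]] := GG.1 _ Gg.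
  have [|u' [_ hu' hc]] := GU a s u e hu; first by rewrite -eg.
  by rewrite eg; eexists _, _, u', e; split=> //; exact: hat_conj.
- move=> t; rewrite /trans /conjG.
  have -> : F \o nact 0 t 1 false \o F' = nact 0 (delta al be * t) 1 false.
    have := @hat_conj al be d0 0 (delta al be * t) 1 false 1.
    rewrite mulKf // => h.
    have L0 : Lin' al be 0 = 0 by rewrite /Lin' cconj0 !mulr0 subr0 mulr0.
    by move: h; rewrite L0 => <- => [|x]; rewrite ?conj_cancel // !mul1r.
  by move=> /Gc [n hn]; exists n; rewrite mulrA -hn mulrC mulKf.
- move=> a s u e hu hg; have [a0 [s0 [u0 [e0 [hu0 eg]]]]] := GG.1 _ hg.
  have [|u' [Zu' hu' hc]] := GU a0 s0 u0 e0 hu0; first by rewrite -eg.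
  have := @hat_conj al be d0 a0 s0 u0 e0 u' hc.
  by rewrite -eg conj_cancel // => /nact_inj [_ _ -> _].
Qed.

(** * Choice of the ring *)

Section Cases.
Variables (G : (N3 -> N3) -> Prop) (c : RR).
Hypothesis GG : is_subgroup G.
Hypothesis c0 : 0 < c.
Hypothesis Gc : forall t, trans G 0 t -> exists n : int, t = n%:~R * c.

(** The commutator of the translations along [u * l] and [l] has height [4 * cIm u * nsq l], so all
    [nsq l] are multiples of one fixed number. *)
Lemma shortest_vector a s u : unitC u -> G (nact a s u false) -> cIm u != 0 ->
  (exists2 l, lattice G l & l != 0) ->
  exists v, [/\ lattice G v, v != 0 & forall l, lattice G l -> nsq l < nsq v -> l = 0].
Proof.
move=> hu hg u0 [l0 Ll0 ln0].
pose d := `|c / (4 * cIm u)|.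
have cn0 : c != 0 by rewrite gt_eqF.
have cu0 : c / (4 * cIm u) != 0 by rewrite mulf_neq0 // invr_eq0 mulf_neq0 // pnatr_eq0.
have d0 : 0 < d by rewrite normr_gt0.
have nsqE l : lattice G l -> exists n : int, nsq l = n%:~R * (c / (4 * cIm u)).
  move=> Ll; have [t ht] := Ll; have [t' ht'] := lattice_stable GG hu hg Ll.
  have [n hn] := Gc (trans_comm GG ht' ht); exists n; rewrite mulrA -hn.
  have -> : cIm (u * cj false l * cconj l) = cIm u * nsq l.
    by case: (u) (l) => x y [z v]; rewrite /nsq /=; ring.
  by field.
have [] := @ex_min_separated Rdefinitions.R CC (fun l => lattice G l /\ l != 0) nsq d d0.
- by move=> l _; exact: nsq_ge0.
- move=> l m [/nsqE[n hn] _] [/nsqE[k hk] _]; rewrite hn hk -mulrBl -intrB normrM.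
  rewrite -/d gtr_pMl // -intr_norm -[1]/(1%:~R) ltr_int => h.
  by have -> : n = k by lia.
- by exists l0.
move=> v [Lv v0] hv; exists v; split=> // l Ll; apply: contraPeq => l0'.
by apply/negP; rewrite -leNgt; exact: hv.
Qed.

Section Shortest.
Variables (v : CC).
Hypothesis Lv : lattice G v.
Hypothesis v0 : v != 0.
Hypothesis vmin : forall l, lattice G l -> nsq l < nsq v -> l = 0.

Lemma shortest_mul x : lattice G (x * v) -> nsq x < 1 -> x = 0.
Proof.
move=> Lx hx; have /vmin : nsq (x * v) < nsq v by rewrite nsqM gtr_pMl ?nsq_gt0.
by move=> /(_ Lx) /eqP; rewrite mulf_eq0 (negbTE v0) orbF => /eqP.
Qed.

(** [(u - 1) * v] and [(u + 1) * v] are nonzero lattice vectors, so [2 - 2 * cRe u] and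
    [2 + 2 * cRe u] are at least 1. *)
Lemma rotation_Re_bound u : unitC u -> lattice G (u * v) -> cIm u != 0 -> cRe u ^+ 2 <= 1 / 4.
Proof.
move=> /unitCP; rewrite /nsq => hu Lu u0.
have h1 : ~ nsq (u - 1) < 1.
  have : lattice G ((u - 1) * v) by rewrite mulrBl mul1r; exact: latticeB.
  move=> /shortest_mul h /h /eqP; rewrite subr_eq0 => /eqP uE.
  by move: u0; rewrite uE /= eqxx.
have h2 : ~ nsq (u + 1) < 1.
  have : lattice G ((u + 1) * v) by rewrite mulrDl mul1r; exact: latticeD.
  move=> /shortest_mul h /h /eqP; rewrite addr_eq0 => /eqP uE.
  by move: u0; rewrite uE /= oppr0 eqxx.
move: hu h1 h2; case: (u) => x y; rewrite /nsq /= => hu.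
move=> /negP; rewrite -leNgt => h1 /negP; rewrite -leNgt => h2.
have {}h1 : x <= 1 / 2 by nra.
have {}h2 : - (1 / 2) <= x by nra.
nra.
Qed.

(** If [x = cRe u] is nonzero, [u * u] is not real; the bound for its real part [2 * x ^+ 2 - 1]
    gives [x ^+ 2 >= 1 / 4]. *)
Lemma crystallographic u : unitC u -> (forall l, lattice G l -> lattice G (u * l)) ->
  cIm u != 0 -> cRe u = 0 \/ cRe u ^+ 2 = 1 / 4.
Proof.
move=> hu su u0; have h1 := rotation_Re_bound hu (su _ Lv) u0.
have [->|r0] := eqVneq (cRe u) 0; [by left|right].
have := rotation_Re_bound (unitCM hu hu); rewrite -mulrA => /(_ (su _ (su _ Lv))).
have -> : cIm (u * u) = 2 * (cRe u * cIm u) by case: (u) => x y /=; ring.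
rewrite !mulf_neq0 ?pnatr_eq0 // => /(_ isT) h2; move/unitCP: hu; rewrite /nsq.
move: h1 h2 r0 u0; case: (u) => x y /= h1 h2 _ _ hu.
have {}h2 : (2 * x ^+ 2 - 1) ^+ 2 <= 1 / 4.
  have <- : x * x - y * y = 2 * x ^+ 2 - 1 by lra.
  exact: h2.
nra.
Qed.

(** Having [w] in Z[u] lets stability of the lattice pass from [u] to [w]. *)
Lemma crystallographic_quad u : unitC u -> (forall l, lattice G l -> lattice G (u * l)) ->
  cIm u != 0 -> exists w b, [/\ quad w b, w = Ci \/ w = zeta3 & Zw u w].
Proof.
move=> hu su u0; have [h|h] := crystallographic hu su u0; move/unitCP: hu; rewrite /nsq h.
  rewrite expr0n /= add0r => /eqP; rewrite sqrf_eq1 => hi.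
  exists Ci, 0; split; [exact: quad_Ci|by left|].
  have -> : u = Complex 0 (cIm u) by exact: CC_ext.
  case/orP: hi => /eqP ->; [exists 0, 1|exists 0, (-1)]; apply: CC_ext => /=; ring.
move=> hi; exists zeta3, (-1); split; [exact: quad_zeta3|by right|].
have h3 : (Num.sqrt (3 : RR) / 2) ^+ 2 = 3 / 4.
  by rewrite expr_div_n sqr_sqrtr // ?ler0n //; field.
have {}hi : (cIm u == Num.sqrt 3 / 2) || (cIm u == - (Num.sqrt 3 / 2)).
  by rewrite -eqf_sqr h3; apply/eqP; lra.
have {}h : (cRe u == 1 / 2) || (cRe u == - (1 / 2)).
  by rewrite -eqf_sqr h; apply/eqP; field.
have -> : u = Complex (cRe u) (cIm u) by exact: CC_ext.
case/orP: hi => /eqP ->; case/orP: h => /eqP ->.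
- by exists (-1), 1; apply: CC_ext => /=; field.
- by exists 0, 1; apply: CC_ext => /=; field.
- by exists 0, (-1); apply: CC_ext => /=; field.
- by exists (-1), (-1); apply: CC_ext => /=; field.
Qed.

Lemma near_int (x : RR) : exists n : int, `|x - n%:~R| <= 1 / 2.
Proof.
pose y : Rdefinitions.R := x + 1 / 2.
have /andP[h1 h2] := real_floor_itv (num_real y).
exists (Num.floor y); move: h1 h2; rewrite intrD /y => h1 h2.
by rewrite ler_norml; apply/andP; split; lra.
Qed.

(* Z[w] is Euclidean, so a w-stable lattice is generated over Z[w] by a shortest vector. *)
Lemma lattice_principal w b l : quad w b -> (forall l, lattice G l -> lattice G (w * l)) ->
  lattice G l -> Zw w (l / v).
Proof.
move=> hw sw Ll; have [hb _ _ w0] := hw; set z := l / v.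
have wn0 : cIm w != 0 by rewrite gt_eqF.
pose y := cIm z / cIm w; pose x := cRe z - y * cRe w.
have zE : z = x%:C%C + y%:C%C * w.
  by apply: CC_ext; rewrite /x /y; case: (z) (w) wn0 => p q [r s] /= ?; field.
have [p hp] := near_int x; have [q hq] := near_int y.
exists p, q; apply/eqP; rewrite -subr_eq0; apply/eqP; apply: shortest_mul.
  rewrite mulrBl divfK // mulrDl -mulrA.
  by apply: latticeB => //; apply: latticeD => //; apply: latticeZ => //; exact: sw.
have -> : z - (p%:~R%:C%C + q%:~R%:C%C * w) = (x - p%:~R)%:C%C + (y - q%:~R)%:C%C * w.
  by rewrite zE; ring.
rewrite (nsq_Zw hw); move: hp hq; rewrite !ler_norml => /andP[h1 h2] /andP[h3 h4].
move: (x - p%:~R) (y - q%:~R) h1 h2 h3 h4 => X Y h1 h2 h3 h4.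
(* With [X] and [Y] at most 1/2 in absolute value, the norm form is at most 3/4. *)
by case: hb => -> /=; nra.
Qed.

End Shortest.

(** Division by the shortest vector [v] turns the lattice into Z[w]; a linear part then sends 1 to a
    lattice vector divided by [v], so into Z[w]. *)
Lemma conj_int_rotation a s u : unitC u -> G (nact a s u false) -> cIm u != 0 ->
  (exists2 l, lattice G l & l != 0) ->
  exists w, (w = Ci \/ w = zeta3) /\ conj_int w G.
Proof.
move=> hu hg u0 hl; have [v [Lv v0 vmin]] := shortest_vector hu hg u0 hl.
have su l : lattice G l -> lattice G (u * l) by exact: (lattice_stable GG hu hg).
have [w [b [hw wE [p [q hwu]]]]] := crystallographic_quad Lv v0 vmin hu su u0.
exists w; split=> //.
have sw l : lattice G l -> lattice G (w * l).
  move=> Ll; rewrite hwu mulrDl -mulrA.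
  by apply: latticeD => //; apply: latticeZ => //; exact: su.
have LE x : Lin v 0 x = v * x by rewrite /Lin mul0r addr0.
have n0 : nsq v != 0 by rewrite gt_eqF ?nsq_gt0.
apply: (@conj_int_hat w b G c v 0 hw GG Gc).
- by rewrite /delta [nsq 0](_ : _ = 0) ?subr0 //; rewrite /nsq /=; ring.
- by rewrite LE mulr1.
- by rewrite LE mulrC; exact: sw.
move=> a' s' u' e hu' hg'; exists (u' * cj e v / v); split.
- by apply: (lattice_principal Lv v0 vmin hw sw); exact: lattice_stable hg' Lv.
- apply/unitCP/(mulIf n0); rewrite -nsqM divfK // nsqM nsq_cj.
  by rewrite (unitCP _).1.
- move=> x; rewrite !LE cjM; by field.
Qed.

End Cases.

Lemma unit_real u : unitC u -> cIm u = 0 -> u = 1 \/ u = -1.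
Proof.
move=> /unitCP + hi; rewrite /nsq hi expr0n addr0 => /eqP; rewrite sqrf_eq1.
by case/orP => /eqP hr; [left|right]; apply: CC_ext; rewrite ?hr ?hi //= oppr0.
Qed.

(** * The case where all rotation parts are real *)

Section Reflections.
Variables (G : (N3 -> N3) -> Prop) (c : RR).
Hypothesis GG : is_subgroup G.
Hypothesis Gc : forall t, trans G 0 t -> exists n : int, t = n%:~R * c.
Hypothesis Gr : forall a s u, unitC u -> G (nact a s u false) -> cIm u = 0.

(* mu1 and mu2 span the two eigenlines of the linear part of an element with
   e = true, if there is one. *)
Lemma adapted_frame l m : lattice G l -> lattice G m -> cIm (m * cconj l) != 0 ->
  exists mu1 mu2, [/\ lattice G mu1, lattice G mu2, cIm (mu2 * cconj mu1) != 0 &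
    forall a s u, unitC u -> G (nact a s u true) -> exists2 ep : CC, ep = 1 \/ ep = -1 &
      u * cconj mu1 = ep * mu1 /\ u * cconj mu2 = - (ep * mu2)].
Proof.
move=> Ll Lm lm0.
have [[a0 [s0 [u0 [hu0 hg0]]]]|nex] :=
    pselect (exists a s u, unitC u /\ G (nact a s u true)); last first.
  by exists l, m; split=> // a s u hu hg; case: nex; exists a, s, u.
pose sig z := u0 * cconj z.
have sigL z : lattice G z -> lattice G (sig z) := lattice_stable GG hu0 hg0.
have sigK z : sig (sig z) = z.
  by rewrite /sig cconjM cconjK mulrA hu0 mul1r.
have sigD x y : sig (x + y) = sig x + sig y by rewrite /sig cconjD mulrDr.
have sigN x : sig (- x) = - sig x by rewrite /sig cconjN mulrN.
have sig2 x y : cIm (sig x * cconj (sig y)) = - cIm (x * cconj y).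
  by rewrite /sig cIm_mul2 // (cIm_cj2 true).
(* [sig] reverses the area form, so it cannot act on both [l] and [m] by the same sign. *)
have nonscalar (ep : CC) : ep = 1 \/ ep = -1 -> exists2 z, lattice G z & z + ep * sig z != 0.
  move=> hep; have [zl|nl] := eqVneq (l + ep * sig l) 0; last by exists l.
  have [zm|nm] := eqVneq (m + ep * sig m) 0; last by exists m.
  case/negP: lm0; apply/eqP; have := sig2 m l.
  have sE z : z + ep * sig z = 0 -> sig z = - (ep * z).
    case: hep => ->; rewrite ?mul1r ?mulN1r ?opprK.
      by move/eqP; rewrite addrC addr_eq0 => /eqP.
    by move/eqP; rewrite subr_eq0 => /eqP.
  rewrite (sE _ zl) (sE _ zm).
  have -> : - (ep * m) * cconj (- (ep * l)) = m * cconj l.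
    have h1 : ep * cconj ep = 1 by case: hep => ->; rewrite ?cconjN cconj1; ring.
    rewrite cconjN cconjM.
    by transitivity ((ep * cconj ep) * (m * cconj l)); [ring|rewrite h1 mul1r].
  by lra.
have [z1 L1 n1] := nonscalar 1 (or_introl erefl).
have [z2 L2 n2] := nonscalar (-1) (or_intror erefl).
(* Eigenvectors of the involution [sig], for 1 and -1. *)
move: n1 n2; rewrite mul1r mulN1r; set mu1 := z1 + _; set mu2 := z2 - _ => n1 n2.
have s1 : sig mu1 = mu1 by rewrite /mu1 sigD sigK addrC.
have s2 : sig mu2 = - mu2 by rewrite /mu2 sigD sigN sigK; ring.
exists mu1, mu2; split.
- by apply: latticeD => //; exact: sigL.
- by apply: latticeB => //; exact: sigL.
(* [sig] is an isometry, so its eigenvectors [mu1] and [mu2] are orthogonal; were they also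
   parallel, one would vanish. *)
- apply/negP => /eqP h0.
  have hR : cRe (mu2 * cconj mu1) = 0.
    have : cRe (sig mu2 * cconj (sig mu1)) = cRe (mu2 * cconj mu1).
      rewrite /sig; move/unitCP: hu0 => h; rewrite -[RHS]mul1r -h.
      by case: (u0) (mu1) (mu2) => p q [r s] [x y]; rewrite /nsq /=; ring.
    by rewrite s1 s2 mulNr; case: (mu2 * cconj mu1) => x y /=; lra.
  have : mu2 * cconj mu1 = 0 by exact: CC_ext.
  move/eqP; rewrite mulf_eq0 (negbTE n2) /= => /eqP h.
  by move: n1; rewrite -[mu1]cconjK h cconj0 eqxx.
move=> a s u hu hg.
have := subgroupM GG hu hg (subgroupV GG hu0 hg0); rewrite cjK.
have hc := unitCM hu (unitC_cj true hu0).
move=> hG; exists (u * cconj u0); first exact: unit_real hc (Gr hc hG).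
have uE z : u * cconj z = (u * cconj u0) * sig z.
  rewrite /sig; transitivity ((u0 * cconj u0) * (u * cconj z)); last by ring.
  by rewrite hu0 mul1r.
by rewrite (uE mu1) (uE mu2) s1 s2 mulrN.
Qed.

(** In the coordinates of the frame, elements with [iota] act linearly as conjugation up to sign,
    while +-1 commutes with every linear change. *)
Lemma conj_int_reflection :
  (exists l m, [/\ lattice G l, lattice G m & cIm (m * cconj l) != 0]) ->
  conj_int Ci G.
Proof.
move=> [l [m [Ll Lm lm0]]].
have [m1 [m2 [L1 L2 d0 hm]]] := adapted_frame Ll Lm lm0.
(* The solution of [Lin al be 1 = m1] and [Lin al be Ci = m2]. *)
pose al := (1 / 2)%:C%C * (m1 - Ci * m2); pose be := (1 / 2)%:C%C * (m1 + Ci * m2).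
have LE (x y : RR) : Lin al be (Complex x y) = x%:C%C * m1 + y%:C%C * m2.
  rewrite /Lin /al /be; case: (m1) (m2) => p q [r s].
  by apply: CC_ext => /=; field.
apply: (@conj_int_hat Ci 0 G c al be quad_Ci GG Gc).
- have -> : delta al be = cIm (m2 * cconj m1) => //.
  by rewrite /delta /al /be; case: (m1) (m2) => p q [r s]; rewrite /nsq /=; field.
- have -> : 1 = Complex 1 0 :> CC by [].
  by rewrite LE rmorph1 rmorph0 mul1r mul0r addr0.
- by rewrite LE rmorph1 rmorph0 mul1r mul0r add0r.
have Zep (ep : CC) : ep = 1 \/ ep = -1 -> Zw Ci ep /\ unitC ep.
  case=> ->; split; [exact: Zw1|exact: unitC1|exact: (ZwN (Zw1 Ci))|].
  by apply/unitCP; rewrite /nsq /=; ring.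
move=> a s u [] hu hg; last first.
  have hep := unit_real hu (Gr hu hg); have [Zu _] := Zep _ hep.
  exists u; split=> // x /=; case: hep => ->; first by rewrite !mul1r.
  by rewrite !mulN1r /Lin cconjN; ring.
have [ep hep [h1 h2]] := hm _ _ _ hu hg; have [Ze ue] := Zep _ hep.
exists ep; split=> // -[x y] /=.
have -> : Lin al be (ep * cconj (Complex x y)) = ep * Lin al be (cconj (Complex x y)).
  case: hep => ->; first by rewrite !mul1r.
  by rewrite !mulN1r /Lin cconjN; ring.
rewrite -[cconj (Complex x y)]/(Complex x (- y)) !LE.
have -> : cconj (x%:C%C * m1 + y%:C%C * m2) = x%:C%C * cconj m1 + y%:C%C * cconj m2.
  by apply: CC_ext; case: (m1) (m2) => p q [r s'] /=; ring.
transitivity (x%:C%C * (u * cconj m1) + y%:C%C * (u * cconj m2)); first by ring.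
by rewrite h1 h2 rmorphN; ring.
Qed.

End Reflections.

(** * Assembly and passage to the rings of integers *)

Lemma closed_nil3_conj_int G : closed_nil3_group G ->
  exists w, (w = Ci \/ w = zeta3) /\ conj_int w G.
Proof.
move=> [GG [GD [_ GC]]].
have [l [m [Ll Lm lm0]]] := lattice_rank2 GG GC.
have [c [c0 _ Gc]] : exists c, [/\ 0 < c, trans G 0 c &
    forall t, trans G 0 t -> exists n : int, t = n%:~R * c].
  apply: center_cyclic => //; have [t ht] := Ll; have [r hr] := Lm.
  exists (4 * cIm (m * cconj l)); first exact: (trans_comm GG hr ht).
  by rewrite mulf_neq0 ?pnatr_eq0.
have ln0 : l != 0.
  by apply: contra_neq lm0 => ->; rewrite cconj0 mulr0.
have [[a [s [u [hu hg u0]]]]|nex] :=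
    pselect (exists a s u, [/\ unitC u, G (nact a s u false) & cIm u != 0]).
  by apply: (conj_int_rotation GG c0 Gc hu hg u0); exists l.
exists Ci; split; first by left.
apply: (conj_int_reflection GG Gc); last by exists l, m.
move=> a s u hu hg; apply/eqP; apply: contrapT => /negP u0.
by case: nex; exists a, s, u.
Qed.

Lemma Zw_alg_integer w b z : quad w b -> Zw w z -> alg_integer z.
Proof.
(* The trace and the norm of [p + q * w]. *)
move=> hw [p [q ->]]; pose t := 2 * p + q * b; pose n := p ^+ 2 + b * p * q + q ^+ 2.
exists ('X^2 + ((- t)%:P * 'X + n%:P)); split.
  rewrite monicE lead_coefDl ?lead_coefXn // size_polyXn size_MXaddC.
  by case: ifP => // _; rewrite !ltnS size_polyC_leq1.
have [_ hw2 _ _] := hw.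
have ev (d k : int) (x : CC) :
    (map_poly intr ('X^2 + (d%:P * 'X + k%:P))).[x] = x ^+ 2 + d%:~R * x + k%:~R.
  rewrite !rmorphD rmorphM rmorphXn /= map_polyX !map_polyC /=.
  by rewrite !(hornerD, hornerM, hornerX, hornerC) addrA.
rewrite -[map_poly _ _]/(map_poly intr _) /root ev; apply/eqP.
have E (k : int) : k%:~R%:C%C = k%:~R :> CC by rewrite rmorph_int.
rewrite !E.
transitivity (q%:~R ^+ 2 * (w ^+ 2 - (b%:~R * w - 1))); first by rewrite /t /n; ring.
by rewrite hw2 E subrr mulr0.
Qed.

Lemma NilZ_over w b k f : quad w b -> (forall z, Zw w z -> k z) ->
  NilZ w f -> Nil3IotaOver (ring_of_integers k) f.
Proof.
move=> hw hk [a [s [u [e [Za [n hs] Zu hu ->]]]]].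
have O z : Zw w z -> ring_of_integers k z.
  by move=> Zz; split; [exact: hk|exact: Zw_alg_integer hw Zz].
exists a, s, u, e; split; first exact: O.
split; last by split; [exact: O|].
exists (n%:~R%:C%C * w); split; last by rewrite cImZ.
by apply/O/(ZwM hw); [exact: Zwz|exact: Zww].
Qed.

Lemma conj_int_faithful w b k G : quad w b -> (forall z, Zw w z -> k z) ->
  conj_int w G -> exists phi, faithful_rep G (Nil3IotaOver (ring_of_integers k)) phi.
Proof.
move=> hw hk [F [F' [FK F'K hF]]]; exists (fun g => F' \o g \o F); split.
  by move=> g Gg; apply: NilZ_over hw hk _; exact: hF.
split=> [g h _ _|g h _ _ E]; first by apply/funext => x /=; rewrite F'K.
by rewrite -[g](conj_cancel _ F'K) E conj_cancel.
Qed.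

Theorem mainTheorem20 (Gamma : (N3 -> N3) -> Prop) :
  closed_nil3_group Gamma ->
  exists k : CC -> Prop, (k = QQi \/ k = QQzeta3) /\
    exists phi : (N3 -> N3) -> (N3 -> N3),
      faithful_rep Gamma (Nil3IotaOver (ring_of_integers k)) phi.
Proof.
move=> /closed_nil3_conj_int [w [wE hc]].
have ZQ z : Zw w z -> exists p q : rat, z = ratr p + ratr q * w.
  by move=> [p [q ->]]; exists p%:~R, q%:~R; rewrite !ratr_int !rmorph_int.
case: wE hc ZQ => -> hc ZQ; [exists QQi|exists QQzeta3]; split.
- by left.
- exact: conj_int_faithful quad_Ci ZQ hc.
- by right.
- exact: conj_int_faithful quad_zeta3 ZQ hc.
Qed.
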